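(* Let $X \neq \{0\}$ be a real Banach space with the Daugavet property. Then there is a convex and closed (bounded) set $\tilde C \subset X$ which is aSCD but not SCD.
   Context: All Banach spaces are real. For a non-empty bounded set $A \subset X$, a slice of $A$ is a (non-empty) set of the form $S(A,x^*,\varepsilon)=\{x\in A : x^*(x) > \sup_{a\in A} x^*(a)-\varepsilon\}$ with $x^*\in X^*\setminus\{0\}$ and $\varepsilon>0$. A bounded set $A\subset X$ is SCD (slicely countably determined) if there is a sequence $(S_n)_{n\in\mathbb N}$ of slices of $A$ such that for every $B\subset X$ with $B\cap S_n\neq\emptyset$ for all $n$ one has $A\subset\overline{\mathrm{conv}}(B)$ (norm-closed convex hull). A bounded set $A\subset X$ is aSCD (almost SCD) if there is a sequence $(S_n)_{n\in\mathbb N}$ of slices of $A$ such that for every $B\subset X$ with $B\cap S_n\neq\emptyset$ for all $n$ one has $A\subset\overline{\mathrm{aconv}}(B)$ (norm-closed absolutely convex hull). Both notions are defined for bounded sets only. A Banach space $X$ has the Daugavet property if every bounded linear rank-one operator $T\colon X\to X$ satisfies $\|I+T\|=1+\|T\|$. *)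

(* Defs.v *)
From mathcomp Require Export all_boot all_order all_algebra.
From mathcomp Require Export all_classical all_reals all_analysis.

Set Implicit Arguments.
Unset Strict Implicit.
Unset Printing Implicit Defensive.

Export Order.TTheory GRing.Theory Num.Theory.
Export numFieldNormedType.Exports.

Local Open Scope classical_set_scope.
Local Open Scope ring_scope.

Section SCD.
Context {R : realType} {X : normedModType R}.
Implicit Types (A B S : set X).

Definition balanced_set A :=
  forall (a : R) (x : X), `|a| <= 1 -> A x -> A (a *: x).

Definition absolutely_convex_set A := convex_set A /\ balanced_set A.

Definition closed_conv B : set X := closure (smallest (@convex_set R X) B).

Definition closed_aconv B : set X :=
  closure (smallest absolutely_convex_set B).

Definition slice A (f : X -> R^o) (eps : R) : set X :=
  [set x | A x /\ sup (f @` A) - eps < f x].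

(* [sup] takes the junk value 0 on empty or unbounded sets, so [A] is required
   to be non-empty and bounded.  A slice is then automatically non-empty. *)
Definition is_slice A S :=
  [/\ A !=set0, bounded_set A &
    exists (f : {linear X -> R^o}) (eps : R),
      [/\ continuous f, exists x, f x != 0, 0 < eps & S = slice A f eps]].

Definition SCD A :=
  bounded_set A /\
  exists S_ : nat -> set X,
    (forall n, is_slice A (S_ n)) /\
    forall B, (forall n, B `&` S_ n !=set0) -> A `<=` closed_conv B.

Definition aSCD A :=
  bounded_set A /\
  exists S_ : nat -> set X,
    (forall n, is_slice A (S_ n)) /\
    forall B, (forall n, B `&` S_ n !=set0) -> A `<=` closed_aconv B.

End SCD.

Section Daugavet.
Context {R : realType}.

(* Meaningful for functions bounded on the unit ball; [sup] is 0 otherwise. *)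
Definition op_norm {X Y : normedModType R} (f : X -> Y) : R :=
  sup [set `|f x| | x in [set x : X | `|x| <= 1]].

Definition rank_one {X Y : normedModType R} (f : X -> Y) :=
  exists2 y : Y, y != 0 & range f = [set a *: y | a in [set: R]].

Definition daugavet (X : normedModType R) :=
  forall T : {linear X -> X}, bounded_fun_norm T -> rank_one T ->
    op_norm (fun x => x + T x) = 1 + op_norm T.

End Daugavet.

(* Main.v *)
From HB Require Import structures.
Require Import Defs.
From mathcomp Require Import ring lra.

(** The set is built around a countable family of points [u i] of the unit ball
    which is rich in l1-like sequences. By the Daugavet property, each slice of the
    unit ball contains points [x] that are quasi-orthogonal to any given finite set
    of vectors: the norm is almost additive on [y + t x] ([slice_quasi_orth]). By
    separation, every point of the ball is then approximated by convex combinations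
    of such points ([quasi_orth_approx]), and a countable closure process yields the
    family [u] ([quasi_orth_skeleton]). Against slices of the closed convex hull of
    the [u i] one can choose points that successively are quasi-orthogonal, and the
    closed convex hull of these choices misses some [u i], so that this hull is not
    SCD.

    To obtain a set that is aSCD, two directions [e1], [e2] are set apart, with
    biorthogonal functionals [h1], [h2], and the [u i] are projected to the common
    kernel of [h1] and [h2]. The projected copy is placed at the point [(1, 0)] of
    the plane of coordinates [(h1, h2)]: these are the flat points. The negatives of
    the projected points, each of them repeated infinitely often, are placed at
    distinct points [(t ^+ 2 - 1, t)] of a parabola, with [t] tending to [0]: these
    are the tips. The required set is the closed convex hull of flat points and tips.

    Each tip is strongly exposed, because each point of a discrete subset of the
    parabola is, and this uses two coordinates only ([tip_strongly_exposed]). Hence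
    countably many slices determine all the tips. As tips accumulate at the
    negatives of the flat points, absolutely convex hulls recover the flat points,
    and the set is aSCD ([aSCD_tipped_set]). Convex hulls do not recover them: tips
    have [h1 <= 0] whereas flat points have [h1 = 1], so that convex combinations
    approaching a flat point use essentially flat points, and then the
    quasi-orthogonal choices, made orthogonal to [e1] and [e2] too, show that the
    set is not SCD ([not_SCD_tipped_set]). *)

Set Implicit Arguments.
Unset Strict Implicit.
Unset Printing Implicit Defensive.

Local Open Scope classical_set_scope.
Local Open Scope ring_scope.

(** * The Hahn-Banach theorem *)

Section HahnBanach.
Context {R : realType} {X : lmodType R}.
Implicit Types (p q : X -> R) (x y z : X).

Definition sublinear p :=
  (forall x y, p (x + y) <= p x + p y) /\
  (forall t x, 0 < t -> p (t *: x) <= t * p x).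

Lemma sublinear0 p : sublinear p -> p 0 = 0.
Proof.
case=> _ pZ.
have := pZ 2 0 (ltr0Sn _ 1); rewrite scaler0 => p2.
have := pZ 2^-1 0 ltac:(by rewrite invr_gt0); rewrite scaler0 => ph.
by apply/eqP; rewrite eq_le; apply/andP; split; lra.
Qed.

Lemma sublinear_oppr_ge p x : sublinear p -> - p (- x) <= p x.
Proof.
move=> sp; have := sp.1 x (- x); rewrite subrr sublinear0//; lra.
Qed.

Lemma le_infD (A B : set R) (c : R) : A !=set0 -> B !=set0 ->
  (forall a b, A a -> B b -> c <= a + b) -> c <= inf A + inf B.
Proof.
move=> A0 B0 cAB; rewrite -lerBlDr; apply: lb_le_inf => // a Aa.
rewrite lerBlDr addrC -lerBlDr; apply: lb_le_inf => // b Bb.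
by rewrite lerBlDr addrC; exact: cAB.
Qed.

Lemma le_infM (A : set R) (c t : R) : 0 < t -> A !=set0 ->
  (forall a, A a -> c <= t * a) -> c <= t * inf A.
Proof.
move=> t0 A0 cA; rewrite -ler_pdivrMl//; apply: lb_le_inf => // a Aa.
by rewrite ler_pdivrMl//; exact: cA.
Qed.

(** Sublinearity forces [- p a <= q (- a)] for any sublinear [q] with
    [q a = p a]; the tilt [q x = inf {p (x + t a) - t p a, t >= 0}] attains this
    least value. It is what makes minimal sublinear functionals odd, and it also
    prescribes the value of the functional given by Hahn-Banach. *)
Lemma sublinear_tilt p a : sublinear p ->
  exists q, [/\ sublinear q, forall x, q x <= p x & q (- a) <= - p a].
Proof.
move=> sp; have [pD pZ] := sp.
pose V x := [set p (x + t *: a) - t * p a | t in [set t : R | 0 <= t]].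
have V0 x : V x !=set0 by exists (p (x + 0 *: a) - 0 * p a); exists 0 => /=.
have Vlb x : has_lbound (V x).
  exists (- p (- x)) => _ [t /= t0 <-].
  have := pD (x + t *: a) (- x); rewrite addrAC subrr add0r.
  have [->|tn0] := eqVneq t 0; first by rewrite !scale0r sublinear0 ?addr0 //; lra.
  have {tn0}t0 : 0 < t by rewrite lt_def tn0.
  have : t * p a <= p (t *: a).
    have := pZ t^-1 (t *: a); rewrite scalerA mulVf ?gt_eqF// scale1r.
    rewrite invr_gt0 => /(_ t0); rewrite ler_pdivlMl//; lra.
  lra.
have qV x t : 0 <= t -> inf (V x) <= p (x + t *: a) - t * p a.
  by move=> t0; apply: ge_inf => //; exists t.
exists (fun x => inf (V x)); split.
- split=> [x y|t x t0].
    apply: le_infD => // _ _ [s /= s0 <-] [t /= t0 <-].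
    apply: (le_trans (qV _ (s + t) _)); first by rewrite addr_ge0.
    rewrite scalerDl addrACA; have := pD (x + s *: a) (y + t *: a); lra.
  apply: le_infM => // _ [s /= s0 <-].
  apply: (le_trans (qV _ (t * s) _)); first by rewrite mulr_ge0// ltW.
  rewrite -scalerA -scalerDr; have := pZ t (x + s *: a) t0; lra.
- by move=> x; have := qV x 0 (lexx _); rewrite scale0r addr0 mul0r subr0.
- have := qV (- a) 1 ler01.
  by rewrite scale1r addNr sublinear0// mul1r sub0r.
Qed.

(** Zorn's lemma applies because the pointwise infimum of a chain of sublinear
    functionals is sublinear: of two members of the chain, the smaller one bounds
    the infimum at a sum. The bound [- p (- x)] keeps these infima finite. *)
Lemma sublinear_minimal p : sublinear p ->
  exists q, [/\ sublinear q, forall x, q x <= p x &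
    forall r, sublinear r -> (forall x, r x <= q x) -> forall x, r x = q x].
Proof.
move=> sp; pose P (q : X -> R) := sublinear q /\ forall x, q x <= p x.
pose T := {q | P q}.
pose le_T (q r : T) := `[< forall x, sval r x <= sval q x >].
have p_T : P p by split.
have [| |A Atot|[q [sq qp]] qmin] := @ZL_preorder T (exist P p p_T) le_T.
- by move=> q; apply/asboolP.
- move=> q r s /asboolP qr /asboolP rs; apply/asboolP => x.
  exact: le_trans (rs x) (qr x).
- have [[q0 Aq0]|A0] := pselect (A !=set0); last first.
    by exists (exist P p p_T) => s As; exfalso; apply: A0; exists s.
  pose V x := [set sval q x | q in A].
  have V0 x : V x !=set0 by exists (sval q0 x), q0.
  have Vlb x : has_lbound (V x).
    exists (- p (- x)) => _ [q Aq <-].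
    have [sq qp] := svalP q.
    apply: le_trans (sublinear_oppr_ge x sq); rewrite lerN2; exact: qp.
  have qV x (u : T) : A u -> inf (V x) <= sval u x.
    by move=> Au; apply: ge_inf => //; exists u.
  have V_T : P (fun x => inf (V x)).
    split; last by move=> x; apply: le_trans (qV x _ Aq0) _; apply: (svalP q0).2.
    split=> [x y|t x t0].
      apply: le_infD => // _ _ [q Aq <-] [r Ar <-].
      have [/asboolP qr|/asboolP rq] := Atot _ _ Aq Ar.
        apply: le_trans (qV _ _ Ar) _; have [[rD _] _] := svalP r.
        exact: le_trans (rD _ _) (lerD (qr _) (lexx _)).
      apply: le_trans (qV _ _ Aq) _; have [[qD _] _] := svalP q.
      exact: le_trans (qD _ _) (lerD (lexx _) (rq _)).
    apply: le_infM => // _ [q Aq <-]; apply: le_trans (qV _ _ Aq) _.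
    by have [[_ qZ] _] := svalP q; exact: qZ.
  by exists (exist P _ V_T) => q Aq; apply/asboolP => x; exact: qV.
- exists q; split=> // r sr rq x.
  have r_T : P r.
    by split=> // y; exact: le_trans (rq y) (qp y).
  have /asboolP /= qr := qmin (exist P r r_T) ltac:(by apply/asboolP => y; exact: rq).
  by apply/eqP; rewrite eq_le rq qr.
Qed.

(** A minimal sublinear functional coincides with all its tilts, hence is odd,
    and an odd sublinear functional is linear. *)
Lemma minimal_sublinear_linear p : sublinear p ->
  (forall r, sublinear r -> (forall x, r x <= p x) -> forall x, r x = p x) ->
  exists f : {linear X -> R^o}, forall x, f x = p x.
Proof.
move=> sp pmin.
have pN x : p (- x) = - p x.
  have [q [sq qp qx]] := sublinear_tilt x sp.
  apply/eqP; rewrite eq_le -{1}(pmin q sq qp (- x)) qx /=.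
  by have := sublinear_oppr_ge (- x) sp; rewrite opprK.
have pD x y : p (x + y) = p x + p y.
  apply/eqP; rewrite eq_le sp.1 /=.
  by have := sp.1 (x + y) (- y); rewrite addrK pN; lra.
have pZ0 t x : 0 < t -> p (t *: x) = t * p x.
  move=> t0; apply/eqP; rewrite eq_le sp.2//=.
  have := sp.2 t (- x) t0; rewrite scalerN !pN; lra.
have pZ t x : p (t *: x) = t * p x.
  have [t0|t0|->] := ltgtP t 0; last by rewrite scale0r mul0r sublinear0.
    rewrite -[t]opprK scaleNr pN pZ0 ?oppr_gt0//; lra.
  exact: pZ0.
have plin : linear (p : X -> R^o) by move=> a u v; rewrite pD pZ.
pose L := GRing.isLinear.Build R X R^o _ (p : X -> R^o) plin.
pose f : {linear X -> R^o} := HB.pack (p : X -> R^o) L.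
by exists f.
Qed.

Lemma hahn_banach p z : sublinear p ->
  exists f : {linear X -> R^o}, (forall x, f x <= p x) /\ f z = p z.
Proof.
move=> sp; have [q [sq qp qz]] := sublinear_tilt z sp.
have [r [sr rq rmin]] := sublinear_minimal sq.
have [f fr] := minimal_sublinear_linear sr rmin.
have fp x : f x <= p x by rewrite fr; exact: le_trans (rq x) (qp x).
exists f; split=> //; apply/eqP; rewrite eq_le fp /=.
have : f (- z) <= - p z by rewrite fr; exact: le_trans (rq _) qz.
by rewrite linearN lerN2.
Qed.

End HahnBanach.

(** * Closed convex hulls and separation *)

Section Convex.
Context {R : realType} {X : normedModType R}.
Implicit Types (A B G S : set X) (x y z : X).

Lemma functionalZ (f : {linear X -> R^o}) (a : R) x : f (a *: x) = a * f x.
Proof. by rewrite linearZ. Qed.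

Lemma convex_setP A : convex_set A <->
  forall x y (t : R), 0 <= t <= 1 -> A x -> A y -> A (t *: x + (1 - t) *: y).
Proof.
split=> [cA x y t /andP[t0 t1] Ax Ay|cA x y l /set_mem Ax /set_mem Ay].
  have /set_mem := cA _ _ (Itv01 t0 t1) (mem_set Ax) (mem_set Ay).
  by [].
apply/mem_set; apply: (cA x y l%:num) => //.
by rewrite ge0 le1.
Qed.

Lemma closureP A x :
  closure A x <-> forall e : R, 0 < e -> exists2 a, A a & `|x - a| < e.
Proof.
split=> [clA e e0|clA B /nbhs_ballP[e /= e0 eB]].
  have [a [Aa]] := clA _ (nbhsx_ballx x e e0).
  by rewrite -ball_normE /= => xa; exists a.
have [a Aa xa] := clA _ e0; exists a; split=> //; apply: eB.
by rewrite -ball_normE.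
Qed.

Lemma convex_closure A : convex_set A -> convex_set (closure A).
Proof.
move=> /convex_setP cA; apply/convex_setP => x y t /andP[t0 t1].
move=> /closureP clx /closureP cly; apply/closureP => e e0.
have [[a Aa xa] [b Ab yb]] := (clx _ e0, cly _ e0).
exists (t *: a + (1 - t) *: b); first by apply: cA => //; rewrite t0.
rewrite opprD addrACA -!scalerBr (le_lt_trans (ler_normD _ _))//.
rewrite !normrZ (ger0_norm t0) ger0_norm ?subr_ge0//.
have [->|tn0] := eqVneq t 0; first by rewrite mul0r add0r subr0 mul1r.
have : t * `|x - a| < t * e by rewrite ltr_pM2l// lt_def tn0.
have : (1 - t) * `|y - b| <= (1 - t) * e.
  by rewrite ler_wpM2l ?subr_ge0// ltW.
lra.
Qed.

Lemma convex_smallest A : convex_set (smallest (@convex_set R X) A).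
Proof.
apply/convex_setP => x y t t01 Sx Sy B /= [cB AB].
have /convex_setP := cB; apply=> //; [exact: Sx|exact: Sy].
Qed.

Lemma convex_closed_conv A : convex_set (closed_conv A).
Proof. exact/convex_closure/convex_smallest. Qed.

Lemma closed_closed_conv A : closed (closed_conv A).
Proof. exact: closed_closure. Qed.

Lemma sub_closed_conv A : A `<=` closed_conv A.
Proof. by move=> x Ax; apply: subset_closure; exact: sub_gen_smallest. Qed.

Lemma closed_conv_sub A S :
  convex_set S -> closed S -> A `<=` S -> closed_conv A `<=` S.
Proof.
move=> cS clS AS; rewrite /closed_conv closureE; apply: smallest_sub => //.
exact: smallest_sub.
Qed.

Lemma absolutely_convex_smallest A :
  absolutely_convex_set (smallest absolutely_convex_set A).
Proof.
split.
  apply/convex_setP => x y t t01 Sx Sy B /= [cB AB].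
  have /convex_setP := cB.1; apply=> //; [exact: Sx|exact: Sy].
move=> a x a1 Sx B /= [cB AB]; apply: cB.2 => //; exact: Sx.
Qed.

Lemma closed_aconvN A x : closed_aconv A x -> closed_aconv A (- x).
Proof.
move=> /closureP clx; apply/closureP => e e0; have [a Aa xa] := clx _ e0.
exists (- a); last by rewrite -opprD normrN.
rewrite -scaleN1r; apply: (absolutely_convex_smallest A).2 => //.
by rewrite normrN1.
Qed.

Lemma convex_closed_aconv A : convex_set (closed_aconv A).
Proof. exact/convex_closure/(absolutely_convex_smallest A).1. Qed.

Lemma closed_aconv_closure A x : closure A x -> closed_aconv A x.
Proof. by apply: closure_subset; exact: sub_gen_smallest. Qed.

(** Sublevel sets of these functions are closed and convex; balls, half-spaces
    and the cones that witness strong exposedness are all of this form, so that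
    an inequality valid on a set passes to its closed convex hull. *)
Definition convex_lipschitz (phi : X -> R) :=
  (exists L, forall x y, `|phi x - phi y| <= L * `|x - y|) /\
  (forall x y (t : R), 0 <= t <= 1 ->
     phi (t *: x + (1 - t) *: y) <= t * phi x + (1 - t) * phi y).

Lemma closed_conv_le phi A : convex_lipschitz phi ->
  (forall x, A x -> phi x <= 0) -> forall x, closed_conv A x -> phi x <= 0.
Proof.
move=> [[L phiL] phic] Aphi x.
apply: (@closed_conv_sub A [set x | phi x <= 0]) => //.
  apply/convex_setP => y z t t01 /= y0 z0; apply: le_trans (phic _ _ _ t01) _.
  have /andP[t0 t1] := t01.
  by rewrite -oppr_ge0 opprD addr_ge0// -mulrN mulr_ge0 ?subr_ge0// oppr_ge0.
move=> y /closureP cly /=; rewrite leNgt; apply/negP => y0.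
have [a /= a0 ya] := cly (phi y / (`|L| + 1)) ltac:(by rewrite divr_gt0// ltr_wpDl).
have := le_trans (ler_norm _) (phiL y a).
suff : L * `|y - a| < phi y by lra.
rewrite (@le_lt_trans _ _ ((`|L| + 1) * `|y - a|))//.
  by rewrite ler_wpM2r// (le_trans (ler_norm _))// lerDl.
by rewrite mulrC -ltr_pdivlMr// ltr_wpDl.
Qed.

Lemma convex_lipschitz_linear (f : {linear X -> R^o}) (c K : R) :
  (forall x, `|f x| <= K * `|x|) -> convex_lipschitz (fun x => f x + c).
Proof.
move=> fK; split.
  exists K => x y; rewrite opprD addrACA subrr addr0 -linearB; exact: fK.
by move=> x y t _; rewrite linearD !linearZ /= /GRing.scale /=; lra.
Qed.

Lemma convex_lipschitz_norm k : convex_lipschitz (fun x => `|x - k|).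
Proof.
split.
  exists 1 => x y; rewrite mul1r (le_trans (ler_dist_dist _ _)) //.
  by rewrite opprB addrA subrK.
move=> x y t /andP[t0 t1].
have -> : t *: x + (1 - t) *: y - k = t *: (x - k) + (1 - t) *: (y - k).
  by rewrite !scalerBr addrACA -opprD -scalerDl (addrC t) subrK scale1r.
rewrite (le_trans (ler_normD _ _))// !normrZ (ger0_norm t0).
by rewrite ger0_norm ?subr_ge0.
Qed.

Lemma convex_lipschitzD phi psi : convex_lipschitz phi ->
  convex_lipschitz psi -> convex_lipschitz (fun x => phi x + psi x).
Proof.
move=> [[L phiL] phic] [[M psiM] psic]; split.
  exists (L + M) => x y; rewrite opprD addrACA mulrDl.
  by rewrite (le_trans (ler_normD _ _))// lerD.
move=> x y t t01; have := phic x y t t01; have := psic x y t t01; lra.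
Qed.

Lemma continuous_linear_bound (f : {linear X -> R^o}) :
  continuous f -> exists2 K, 0 < K & forall x, `|f x| <= K * `|x|.
Proof.
move=> /linear_bounded_continuous /linear_boundedP fb.
have [K K0 /= fK] := pinfty_ex_gt0 fb.
by exists K.
Qed.

Lemma bound_continuous (f : {linear X -> R^o}) K :
  (forall x, `|f x| <= K * `|x|) -> continuous f.
Proof.
move=> fK; apply/linear_bounded_continuous/bounded_funP => r.
exists (`|K| * r) => x xr; apply: le_trans (fK x) _.
rewrite (le_trans (ler_wpM2r (normr_ge0 _) (ler_norm K)))//.
exact: ler_wpM2l.
Qed.

(** Hahn-Banach is applied to [q x = inf {l + 2 / r * `|x - l a|}], over
    [l >= 0] and [a] in [A]. Convexity of [A] makes [q] sublinear, the choice
    [l = 1] gives [q <= 1] on [A], the choice [l = 0] makes [q] bounded by a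
    multiple of the norm, and the distance from [z] to [A] gives [1 < q z]. *)
Lemma convex_separation A z (r : R) : convex_set A -> A 0 -> 0 < r ->
  (forall a, A a -> r <= `|z - a|) ->
  exists (f : {linear X -> R^o}) (K : R),
    [/\ 0 < K, forall x, `|f x| <= K * `|x|, 1 < f z &
        forall a, A a -> f a <= 1].
Proof.
move=> /convex_setP cA A0 r0 zA; pose K := 2 / r.
have K0 : 0 < K by rewrite divr_gt0.
pose V x := [set v | exists l a, [/\ 0 <= l, A a & v = l + K * `|x - l *: a|]].
have V0 x : V x !=set0 by exists (0 + K * `|x - 0 *: 0|), 0, 0.
have Vge0 x v : V x v -> 0 <= v.
  by move=> [l [a [l0 Aa ->]]]; rewrite addr_ge0// mulr_ge0// ltW.
have Vlb x : has_lbound (V x) by exists 0 => v; exact: Vge0.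
pose q x := inf (V x).
have qV x l a : 0 <= l -> A a -> q x <= l + K * `|x - l *: a|.
  by move=> l0 Aa; apply: ge_inf => //; exists l, a.
have sq : sublinear q.
  split=> [x y|t x t0].
    apply: le_infD => // _ _ [l [a [l0 Aa ->]]] [m [b [m0 Ab ->]]].
    have [c Ac cE] : exists2 c, A c & (l + m) *: c = l *: a + m *: b.
      have [lm0|lm0] := eqVneq (l + m) 0.
        have [-> ->] : l = 0 /\ m = 0 by split; lra.
        by exists 0; rewrite ?addr0 ?scale0r ?addr0.
      have lm : 0 < l + m by rewrite lt_def lm0 addr_ge0.
      exists (l / (l + m) *: a + (1 - l / (l + m)) *: b).
        apply: cA => //; rewrite divr_ge0 ?addr_ge0//= ler_pdivrMr// mul1r.
        by rewrite lerDl.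
      rewrite scalerDr !scalerA mulrBr mulr1 mulrC divfK//.
      by rewrite (addrC l) addrK.
    apply: le_trans (qV (x + y) (l + m) c _ Ac) _; first exact: addr_ge0.
    rewrite cE opprD (addrACA x) [leRHS]addrACA lerD2l -mulrDr ler_pM2l//.
    exact: ler_normD.
  apply: le_infM => // _ [l [a [l0 Aa ->]]].
  apply: le_trans (qV (t *: x) (t * l) a _ Aa) _.
    by rewrite mulr_ge0// ltW.
  rewrite -scalerA -scalerBr normrZ gtr0_norm//; lra.
have [f [fq fz]] := hahn_banach z sq.
exists f, K; split=> //.
- move=> x; rewrite ler_norml.
  have fK y : f y <= K * `|y|.
    apply: le_trans (fq y) _; have := qV y 0 0 (lexx _) A0.
    by rewrite scale0r subr0 add0r.
  by rewrite fK andbT lerNl -linearN -(normrN x) fK.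
- (* For [l <= 1], [l a] is in [A] and the norm term alone is at least 2. For
     [l] slightly above 1, up to [1 + s], it is still at least 1. Beyond that,
     [l] itself is large enough. *)
  pose s := r / (2 * (`|z| + 1)).
  have z1 : 0 < `|z| + 1 by rewrite ltr_wpDl.
  have s0 : 0 < s by rewrite divr_gt0// mulr_gt0.
  rewrite fz (@lt_le_trans _ _ (1 + Num.min 1 s)) ?ltrDl ?lt_min ?ltr01//.
  apply: lb_le_inf => // _ [l [a [l0 Aa ->]]].
  have Kr : K * r = 2 by rewrite /K divfK// gt_eqF.
  have [l1|l1] := leP l 1.
    have Ala : A (l *: a).
      have := cA a 0 l _ Aa A0; rewrite scaler0 addr0; apply.
      by rewrite l0.
    have : K * r <= K * `|z - l *: a| by rewrite ler_pM2l// zA.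
    have : Num.min 1 s <= 1 by rewrite ge_min lexx.
    lra.
  have [ls|ls] := leP (l - 1) s; last first.
    have : Num.min 1 s <= s by rewrite ge_min lexx orbT.
    have : 0 <= K * `|z - l *: a| by rewrite mulr_ge0// ltW.
    lra.
  have : l * r <= `|z - l *: a| + (l - 1) * `|z|.
    have : l * r <= l * `|z - a| by rewrite ler_pM2l ?zA//; lra.
    suff : l * `|z - a| <= `|z - l *: a| + (l - 1) * `|z| by lra.
    rewrite -{1}[l]ger0_norm// -(@ger0_norm _ (l - 1)); last by lra.
    have lE : l *: (z - a) = z - l *: a + (l - 1) *: z.
      by rewrite scalerBr scalerBl scale1r [RHS]addrC addrA subrK.
    rewrite -normrZ lE -normrZ; exact: ler_normD.
  have : (l - 1) * `|z| <= r / 2.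
    have : (l - 1) * (`|z| + 1) <= s * (`|z| + 1) by rewrite ler_pM2r.
    have : s * (`|z| + 1) = r / 2 by rewrite /s; field; rewrite gt_eqF.
    lra.
  move=> h1 h2; have : K * (r / 2) <= K * `|z - l *: a|.
    rewrite ler_pM2l//.
    have : r <= l * r by rewrite ler_peMl// ltW.
    lra.
  have : Num.min 1 s <= 1 by rewrite ge_min lexx.
  lra.
- move=> a Aa; apply: le_trans (fq a) _; have := qV a 1 a ler01 Aa.
  by rewrite scale1r subrr normr0 mulr0 addr0.
Qed.

Lemma norming_functional x : exists f : {linear X -> R^o},
  (forall y, `|f y| <= `|y|) /\ f x = `|x|.
Proof.
have sn : sublinear (fun y : X => `|y|).
  by split=> [y z|t y t0]; [exact: ler_normD|rewrite normrZ gtr0_norm].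
have [f [fn fx]] := hahn_banach x sn; exists f; split=> // y.
by rewrite ler_norml fn andbT lerNl -linearN -(normrN y) fn.
Qed.

End Convex.

(** * Quasi-orthogonality to finitely many vectors *)

Section Boxes.
Context {R : realType} {X : normedModType R}.
Implicit Types (x y z g : X) (s l : seq X) (e M : R).

(** Combinations with coefficients in [[- M, M]]: an explicitly totally bounded
    substitute for a ball of the span of [s]. The vectors in [s] may be linearly
    dependent, or repeated. *)
Fixpoint box M s : set X :=
  if s is x :: s' then
    [set y | exists a b, [/\ `|a| <= M, box M s' b & y = a *: x + b]]
  else [set 0].

Lemma boxN M s y : box M s y -> box M s (- y).
Proof.
elim: s y => [|x s ih] y /= => [->|[a [b [aM sb ->]]]]; first by rewrite oppr0.
exists (- a), (- b); split; [by rewrite normrN|exact: ih|].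
by rewrite opprD scaleNr.
Qed.

(** Up to an error [e], the norm of [y + t x] is that of an l1-sum. The bounded
    range of [y] and [t] allows an additive error, and additive errors simply add
    up along a sequence. *)
Definition quasi_orth M s e x := forall y t,
  box M s y -> 0 <= t <= 1 -> `|y| + t - e <= `|y + t *: x|.

Lemma quasi_orthN M s e x : quasi_orth M s e x -> quasi_orth M s e (- x).
Proof.
move=> sx y t /boxN sy t01; rewrite scalerN -(normrN (y - _)) opprD opprK.
by rewrite -(normrN y); exact: sx.
Qed.

Lemma segment_net M e : 0 < e ->
  exists l : seq R, forall a, `|a| <= M -> exists2 b, b \in l & `|a - b| <= e.
Proof.
move=> e0; pose n := (Num.truncn (2 * M / e)).+1.
exists [seq - M + e * i%:R | i <- iota 0 n] => a.
rewrite ler_norml => /andP[Ma aM].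
have ae0 : 0 <= (a + M) / e by apply: divr_ge0; [lra|exact: ltW].
have /andP[] := truncn_itv ae0; set i := Num.truncn _ => ia ai.
exists (- M + e * i%:R).
  apply/mapP; exists i => //; rewrite mem_iota add0n ltnS /n /i.
  apply: le_truncn; rewrite ler_pM2r ?invr_gt0//; lra.
move: ia ai; rewrite ler_pdivlMr// ltr_pdivrMr// -natr1 => ia ai.
by rewrite ler_norml; apply/andP; split; lra.
Qed.

Lemma box_net M s e : 0 < e ->
  exists l : seq X, forall y, box M s y -> exists2 g, g \in l & `|y - g| <= e.
Proof.
elim: s e => [|x s ih] e e0 /=.
  by exists [:: 0] => y ->; exists 0; rewrite ?inE// subrr normr0 ltW.
have x1 : 0 < `|x| + 1 by rewrite ltr_wpDl.
have [l lP] := ih (e / 2) ltac:(by rewrite divr_gt0).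
have ex0 : 0 < e / 2 / (`|x| + 1) by rewrite !divr_gt0.
have [r rP] := segment_net M ex0.
exists [seq a *: x + g | a <- r, g <- l] => _ [a [b [aM /lP[g lg bg] ->]]].
have [c rc ac] := rP a aM.
exists (c *: x + g); first by apply/allpairsP; exists (c, g).
rewrite opprD addrACA -scalerBl (le_trans (ler_normD _ _))// normrZ.
have : `|a - c| * (`|x| + 1) <= e / 2 by rewrite -ler_pdivlMr.
have := normr_ge0 (a - c); lra.
Qed.

End Boxes.

(** * The Daugavet property yields quasi-orthogonal points in slices *)

Section Daugavet.
Context {R : realType} {X : normedModType R}.
Context (X_neq0 : exists x : X, x != 0) (X_daugavet : daugavet X).
Implicit Types (x y z g : X) (f : {linear X -> R^o}) (s l : seq X) (e c K M : R).

(** The Daugavet equation for [T z = (f z / N) y], with [N] the norm of [f],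
    gives [x0] in the unit ball with [`|x0 + T x0|] almost [1 + `|y|]. A functional
    [u] norming [x0 + T x0] is then almost [1] at [x0] and almost [`|y|] at [y],
    while [f x0] is almost [N]. So [u + f / N] is almost [2] at [x0], and a point
    of the ball where it is almost [2] has [f] close to [N] and [u (y + z)] close
    to [`|y| + 1]. Replacing a slice by a smaller slice, rather than by a point,
    is what permits iteration over finitely many [y]. *)
Lemma slice_refinement f K c x y e : (forall z, `|f z| <= K * `|z|) ->
  0 <= c -> `|x| <= 1 -> c < f x -> y != 0 -> 0 < e ->
  exists (g : {linear X -> R^o}) (L d : R),
    [/\ forall z, `|g z| <= L * `|z|, 0 <= d,
        exists2 z, `|z| <= 1 & d < g z &
        forall z, `|z| <= 1 -> d < g z -> c < f z /\ `|y| + 1 - e <= `|y + z|].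
Proof.
move=> fK c0 x1 cfx y0 e0.
have yn : 0 < `|y| by rewrite normr_gt0.
pose V := [set `|f z| | z in [set z : X | `|z| <= 1]].
have Vub : ubound V `|K|.
  move=> _ [z /= z1 <-]; apply: le_trans (fK z) _.
  apply: le_trans (ler_wpM2r (normr_ge0 _) (ler_norm K)) _.
  by rewrite ler_piMr.
have Vsup : has_sup V.
  by split; [exists `|f x|, x|exists `|K|].
pose N := sup V.
have fN z : `|z| <= 1 -> `|f z| <= N.
  by move=> z1; apply: sup_upper_bound => //; exists z.
have cN : c < N by by apply: lt_le_trans cfx (le_trans _ (fN _ x1)); exact: ler_norm.
have N0 : 0 < N by exact: le_lt_trans c0 cN.
pose T z := (f z / N) *: y.
have Tlin : linear T.
  by move=> a u v; rewrite /T linearP/= mulrDl scalerDl scalerA mulrA.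
pose TL := GRing.isLinear.Build R X X _ T Tlin.
pose T' : {linear X -> X} := HB.pack T TL.
have Tn z : `|T z| = `|f z| / N * `|y|.
  by rewrite /T normrZ normrM normfV (gtr0_norm N0).
have T1 z : `|z| <= 1 -> `|T z| <= `|y|.
  by move=> z1; rewrite Tn ler_piMl// ler_pdivrMr// mul1r fN.
have Tbd : bounded_fun_norm T'.
  move=> r; exists (`|K| * `|r| / N * `|y|) => z zr; rewrite -[T' z]/(T z) Tn.
  rewrite ler_wpM2r// ler_wpM2r ?invr_ge0 ?(ltW N0)//; apply: le_trans (fK z) _.
  rewrite (le_trans (ler_wpM2r (normr_ge0 _) (ler_norm K)))// ler_wpM2l//.
  exact: le_trans zr (ler_norm r).
have Trk : rank_one T'.
  exists y => //; apply/seteqP; split=> [_ [z _ <-]|_ [a _ <-]].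
    by exists (f z / N).
  have fx0 : f x != 0 by rewrite gt_eqF// (le_lt_trans c0).
  exists ((a * N / f x) *: x) => //; rewrite -[T' _]/(T _) /T functionalZ.
  by rewrite divfK// mulfK// gt_eqF.
have TVsup : has_sup [set `|T' z| | z in [set z : X | `|z| <= 1]].
  by split; [exists `|T' x|, x|exists `|y| => _ [z /= z1 <-]; exact: T1].
have Tge : `|y| <= op_norm T'.
  have : N <= op_norm T' / `|y| * N.
    apply: ge_sup; first by exists `|f x|, x.
    move=> _ [z /= z1 <-].
    rewrite -ler_pdivrMr// ler_pdivlMr// -Tn.
    by apply: sup_upper_bound => //; exists z.
  by rewrite -{1}[N]mul1r ler_pM2r// ler_pdivlMr// mul1r.
(* [h] is the defect allowed in the Daugavet equation; the losses [2 h + h / `|y|]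
   of the final estimates have to stay below both [e] and [1 - c / N]. *)
pose h := Num.min e (1 - c / N) / (2 + `|y|^-1).
have cN1 : 0 < 1 - c / N by rewrite subr_gt0 ltr_pdivrMr// mul1r.
have yi : 0 < `|y|^-1 by rewrite invr_gt0.
have y2 : 0 < 2 + `|y|^-1 by rewrite addr_gt0.
have h0 : 0 < h by rewrite divr_gt0// lt_min e0 cN1.
have hE : 2 * h + h / `|y| = Num.min e (1 - c / N).
  by rewrite /h; field; rewrite !gt_eqF//= -[X in X + 1]mulrC.
have he : 2 * h + h / `|y| <= e by rewrite hE ge_min lexx.
have hc : 2 * h + h / `|y| <= 1 - c / N by rewrite hE ge_min lexx orbT.
clearbody h.
have cN0 : 0 <= c / N by rewrite divr_ge0// ltW.
have hy : h / `|y| < 1 by lra.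
have {}hy : h < `|y| by move: hy; rewrite ltr_pdivrMr// mul1r.
have [x0 x01 x0T] : exists2 x0, `|x0| <= 1 & 1 + `|y| - h < `|x0 + T x0|.
  have IT : has_sup [set `|z + T' z| | z in [set z : X | `|z| <= 1]].
    split; first by exists `|x + T' x|, x.
    exists (1 + `|y|) => _ [z /= z1 <-]; apply: le_trans (ler_normD _ _) _.
    by rewrite lerD// T1.
  have [_ [x0 x01 <-] x0T] := sup_adherent h0 IT.
  exists x0 => //; apply: le_lt_trans x0T.
  rewrite -[sup _]/(op_norm (fun z => z + T' z)) X_daugavet//; lra.
have {x0 x01 x0T}[x0 [x01 x0T fx0]] :
    exists x0, [/\ `|x0| <= 1, 1 + `|y| - h < `|x0 + T x0| & 0 <= f x0].
  have [fx0|fx0] := leP 0 (f x0); first by exists x0.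
  exists (- x0); rewrite normrN; split=> //; last by rewrite linearN oppr_ge0 ltW.
  by rewrite /T linearN mulNr scaleNr -opprD normrN.
have [u [u1 uv]] := norming_functional (x0 + T x0).
move: x0T; rewrite -uv linearD /T functionalZ => x0T.
set a := f x0 / N in x0T.
have a0 : 0 <= a by rewrite divr_ge0// ltW.
have a1 : a <= 1 by rewrite ler_pdivrMr// mul1r (le_trans (ler_norm _))// fN.
have ux0 : u x0 <= 1 by rewrite (le_trans (ler_norm _))// (le_trans (u1 _)).
have uy : u y <= `|y| by rewrite (le_trans (ler_norm _)).
have auy : `|y| - h < a * u y by lra.
have uy0 : 0 < u y.
  rewrite ltNge; apply/negP => uy0; have : a * u y <= 0 by rewrite mulr_ge0_le0.
  lra.
have auy1 : a * u y <= u y by rewrite ler_piMl// ltW.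
have auy2 : a * u y <= a * `|y| by rewrite ler_wpM2l.
have aE : 1 - h / `|y| < a.
  have : (1 - h / `|y|) * `|y| < a * `|y| by rewrite mulrBl divfK ?gt_eqF//; lra.
  by rewrite ltr_pM2r.
pose g z := u z + f z / N.
have glin : linear (g : X -> R^o).
  move=> b v w; rewrite /g !linearP /= /GRing.scale /= ; lra.
pose gL := GRing.isLinear.Build R X R^o _ (g : X -> R^o) glin.
pose g' : {linear X -> R^o} := HB.pack (g : X -> R^o) gL.
exists g', (1 + `|K| / N), (2 - h - h / `|y|); split.
- move=> z; rewrite -[g' z]/(g z); apply: le_trans (ler_normD _ _) _.
  rewrite mulrDl mul1r lerD// normrM normfV (gtr0_norm N0) mulrAC.
  rewrite ler_pM2r ?invr_gt0//; apply: le_trans (fK z) _.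
  by rewrite ler_wpM2r// ler_norm.
- lra.
- by exists x0 => //; rewrite -[g' x0]/(g x0) /g -/a; lra.
- move=> z z1; rewrite -[g' z]/(g z) /g => gz.
  have uz : u z <= 1 by rewrite (le_trans (ler_norm _))// (le_trans (u1 _)).
  have fz : f z / N <= 1.
    by rewrite ler_pdivrMr// mul1r (le_trans (ler_norm _))// fN.
  split.
    have : c / N < f z / N by lra.
    by rewrite ltr_pM2r ?invr_gt0.
  rewrite (@le_trans _ _ (u (y + z)))//; first by rewrite linearD; lra.
  by rewrite (le_trans (ler_norm _)).
Qed.

Lemma slice_quasi_orth_seq f K c x l e : (forall z, `|f z| <= K * `|z|) ->
  0 <= c -> `|x| <= 1 -> c < f x -> 0 < e ->
  exists z, [/\ `|z| <= 1, c < f z & forall y, y \in l -> `|y| + 1 - e <= `|y + z|].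
Proof.
have [v v0] := X_neq0.
elim: l f K c x => [|y l ih] f K c x fK c0 x1 cfx e0; first by exists x.
have [y'0|y0] := eqVneq y 0; last first.
  have [g [L [d [gL d0 [x' x'1 dgx'] gP]]]] := slice_refinement fK c0 x1 cfx y0 e0.
  have [z [z1 dz zl]] := ih g L d x' gL d0 x'1 dgx' e0.
  have [cz yz] := gP z z1 dz; exists z; split=> // w.
  by rewrite inE => /predU1P[->|/zl].
(* For [y = 0] the claim is [1 - e <= `|z|]; it follows from the estimate for a
   nonzero vector. *)
have [g [L [d [gL d0 [x' x'1 dgx'] gP]]]] := slice_refinement fK c0 x1 cfx v0 e0.
have [z [z1 dz zl]] := ih g L d x' gL d0 x'1 dgx' e0.
have [cz vz] := gP z z1 dz; exists z; split=> // w.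
rewrite inE => /predU1P[->|/zl//]; rewrite y'0 normr0 !add0r.
by have := ler_normD v z; lra.
Qed.

(** It suffices to treat a finite net of the box, since both sides of the
    inequality are Lipschitz in [y]; the case of [t < 1] follows from [t = 1] by
    the triangle inequality. *)
Lemma slice_quasi_orth M s f K c x e : (forall z, `|f z| <= K * `|z|) ->
  0 <= c -> `|x| <= 1 -> c < f x -> 0 < e ->
  exists z, [/\ `|z| <= 1, c < f z & quasi_orth M s e z].
Proof.
move=> fK c0 x1 cfx e0; have e3 : 0 < e / 3 by rewrite divr_gt0.
have [l lP] := box_net M s e3.
have [z [z1 cz zl]] := slice_quasi_orth_seq l fK c0 x1 cfx e3.
exists z; split=> // y t sy /andP[t0 t1]; have [g lg yg] := lP y sy.
have h1 : `|g + z| <= `|y + t *: z| + `|y - g| + (1 - t).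
  have -> : g + z = y + t *: z + ((g - y) + (1 - t) *: z).
    rewrite scalerBl scale1r [RHS]addrACA (addrC y) subrK.
    by rewrite (addrC (t *: z)) subrK.
  apply: le_trans (ler_normD _ _) _; rewrite -[leRHS]addrA lerD2l.
  apply: le_trans (ler_normD _ _) _; rewrite distrC lerD2l.
  by rewrite normrZ ger0_norm ?subr_ge0// ler_piMr// subr_ge0.
have h2 : `|y| <= `|g| + `|y - g|.
  by rewrite -{1}(subrK g y) addrC; exact: ler_normD.
have := zl g lg; lra.
Qed.

(** If the convex hull of the quasi-orthogonal points stayed away from [p], a
    separating functional would define a slice of the ball containing [p] but no
    quasi-orthogonal point. This hull contains the origin, as the separation
    requires, because quasi-orthogonality is invariant under change of sign. *)
Lemma quasi_orth_approx M s p e : `|p| <= 1 -> 0 < e ->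
  exists l : seq X,
    (forall x, x \in l -> `|x| <= 1 /\ quasi_orth M s e x) /\
    exists2 a, smallest (@convex_set R X) [set` l] a & `|p - a| < e.
Proof.
move=> p1 e0; pose W x := `|x| <= 1 /\ quasi_orth M s e x.
pose A a := exists l : seq X, (forall x, x \in l -> W x) /\
  smallest (@convex_set R X) [set` l] a.
have [[a [l [lW la]] pa]|noa] := pselect (exists2 a, A a & `|p - a| < e).
  by exists l; split=> //; exists a.
(* Convex hulls of finite subsets form a directed family, so that their union
   is convex without any explicit convex combination. *)
have cA : convex_set A.
  apply/convex_setP => x y t t01 [l [lW lx]] [k [kW ky]].
  exists (l ++ k); split.
    by move=> z; rewrite mem_cat => /orP[/lW|/kW].
  have /convex_setP := @convex_smallest R X [set` l ++ k]; apply => //.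
    apply: sub_smallest2r lx; first exact: convex_smallest.
    by move=> z /=; rewrite mem_cat => ->.
  apply: sub_smallest2r ky; first exact: convex_smallest.
  by move=> z /=; rewrite mem_cat orbC => ->.
have WA x : W x -> A x.
  move=> Wx; exists [:: x]; split; first by move=> z; rewrite inE => /eqP ->.
  by apply: sub_gen_smallest => /=; rewrite inE.
have A0 : A 0.
  have [v v0] := X_neq0; have [f [f1 fv]] := norming_functional v.
  have vn : 0 < `|v| by rewrite normr_gt0.
  have [z [z1 _ zo]] : exists z, [/\ `|z| <= 1, 0 < f z & quasi_orth M s e z].
    apply: (@slice_quasi_orth M s f 1 0 (`|v|^-1 *: v)) => //.
    - by move=> z; rewrite mul1r.
    - by rewrite normrZ normfV normr_id mulVf// gt_eqF.
    - by rewrite functionalZ fv mulVf ?gt_eqF.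
  have -> : 0 = 2^-1 *: z + (1 - 2^-1) *: (- z).
    have -> : 1 - 2^-1 = 2^-1 :> R by lra.
    by rewrite scalerN subrr.
  have /convex_setP := cA; apply; first by apply/andP; split; lra.
    exact: WA.
  by apply: WA; split; rewrite ?normrN//; exact: quasi_orthN.
have [a Aa|f [K [K0 fK fp fA]]] := convex_separation (z := p) cA A0 e0.
  by rewrite leNgt; apply/negP => pa; apply: noa; exists a.
have [z [z1 fz zo]] := slice_quasi_orth M s fK ler01 p1 fp e0.
have := fA z (WA z (conj z1 zo)); lra.
Qed.

End Daugavet.

(** * A sequence decreasing to zero with gaps *)

Section Harmonic.
Context {R : realType}.

Definition tau (n : nat) : R := n.+1%:R^-1.

Lemma tau_gt0 n : 0 < tau n. Proof. by rewrite invr_gt0. Qed.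

Lemma tau_le1 n : tau n <= 1. Proof. by rewrite invf_le1// ler1n. Qed.

Lemma tau_mono m n : (m <= n)%N -> tau n <= tau m.
Proof. by move=> mn; rewrite lef_pV2 ?posrE// ler_nat. Qed.

Lemma tau_small (e : R) : 0 < e -> exists n, forall m, (n <= m)%N -> tau m < e.
Proof.
move=> e0; exists (Num.truncn e^-1) => m nm.
apply: le_lt_trans (tau_mono nm) _; rewrite -[ltRHS]invrK ltf_pV2 ?posrE ?invr_gt0//.
have /truncn_itv/andP[_] : 0 <= e^-1 by rewrite invr_ge0 ltW.
exact.
Qed.

(** The gap to both neighbours is at least [tau n * tau n.+1]. *)
Lemma tau_gap n : exists2 d, 0 < d <= 1 &
  forall m, m != n -> d <= (tau m - tau n) ^+ 2.
Proof.
pose d := tau n * tau n.+1.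
have d0 : 0 < d by rewrite mulr_gt0 ?tau_gt0.
have d1 : d <= 1.
  by rewrite mulr_ile1 ?tau_le1 ?(ltW (tau_gt0 _)).
exists (d ^+ 2); first by rewrite exprn_gt0//= expr_le1 ?(ltW d0).
move=> m mn; rewrite -[leRHS]real_normK ?num_real//.
rewrite ler_sqr ?nnegrE ?(ltW d0)//.
have tn := tau_gt0 n.
have tE p : tau p - tau p.+1 = tau p * tau p.+1.
  have p0 : 0 < p.+1%:R :> R by rewrite ltr0n.
  rewrite /tau -[p.+2%:R]natr1; move: p.+1%:R p0 => a a0; field.
  by rewrite !gt_eqF// addr_gt0.
have [lt_mn|lt_nm|/eqP] := ltngtP m n; last by rewrite (negbTE mn).
  case: n lt_mn {mn} @d d0 d1 tn => // n lt_mn d d0 d1 tn.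
  apply: le_trans (ler_norm _).
  have : tau n <= tau m by exact: tau_mono.
  have := tE n; have : d <= tau n * tau n.+1.
    rewrite /d mulrC ler_pM2r ?tau_gt0//; apply: tau_mono.
    exact: leqW (leqnSn n).
  lra.
rewrite distrC; apply: le_trans (ler_norm _).
by have := tau_mono lt_nm; have := tE n; rewrite -/d; lra.
Qed.

End Harmonic.

(** * A countable set rich in quasi-orthogonal points *)

Section Skeleton.
Context {R : realType} {X : normedModType R}.
Context (X_neq0 : exists x : X, x != 0) (X_daugavet : daugavet X).

(** Closing a point under the choices [W] gives a countable set, whose points
    are named by trees: the node with children [p :: s] and with label encoding
    [(n, i)] names the [i]-th element of [W s p n]. *)
Fixpoint tree_point (W : seq X -> X -> nat -> seq X) (t : GenTree.tree nat) : X :=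
  if t is GenTree.Node c ts then
    if (map (tree_point W) ts, unpickle c) is (p :: s, Some (n, i)) then
      nth 0 (W s p n) i
    else 0
  else 0.

Lemma quasi_orth_le M (s : seq X) (d e : R) x :
  d <= e -> quasi_orth M s d x -> quasi_orth M s e x.
Proof. by move=> de sx y t sy t01; have := sx y t sy t01; lra. Qed.

(** This replaces the passage to a separable subspace with the Daugavet
    property: the set is countable, and the quasi-orthogonal points approximating
    each of its points can be found inside it. *)
Lemma quasi_orth_skeleton (M : R) (s0 : seq X) :
  exists (I : countType) (u : I -> X) (i0 : I),
    [/\ forall i, `|u i| <= 1, u i0 = 0 &
      forall (s : seq I) (i : I) (e : R), 0 < e ->
        closed_conv
          [set u j | j in [set j | quasi_orth M (map u s ++ s0) e (u j)]] (u i)].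
Proof.
have /choice[W0 W0P] : forall k : seq X * X * nat, exists l : seq X,
    (forall x, x \in l ->
       `|x| <= 1 /\ quasi_orth M (k.1.1 ++ s0) (tau k.2) x) /\
    (`|k.1.2| <= 1 ->
       exists2 a, smallest (@convex_set R X) [set` l] a & `|k.1.2 - a| < tau k.2).
  move=> [[s p] n] /=; have [p1|p1] := pselect (`|p| <= 1); last by exists [::].
  have [l [lW la]] := quasi_orth_approx X_neq0 X_daugavet M (s ++ s0) p1 (tau_gt0 n).
  by exists l.
pose W s p n := W0 (s, p, n); pose u := tree_point W.
have u1 t : `|u t| <= 1.
  case: t => [k|c ts]; rewrite /u /= ?normr0 ?ler01//.
  case: (map _ ts) => [|p s]; first by rewrite normr0.
  case: (unpickle c) => [[n i]|]; last by rewrite normr0.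
  have [iW|iW] := ltnP i (size (W s p n)); last by rewrite nth_default// normr0.
  by have [] := (W0P (s, p, n)).1 _ (mem_nth 0 iW).
exists (GenTree.tree nat), u, (GenTree.Leaf 0%N); split=> // s i e e0.
apply/closureP => r r0; have er0 : 0 < Num.min e r by rewrite lt_min e0 r0.
have [n /(_ n (leqnn n))] := tau_small er0; rewrite lt_min => /andP[ne nr].
have [lW /(_ (u1 i))[a la ia]] := W0P (map u s, u i, n).
exists a; last exact: lt_trans ia nr.
apply: sub_smallest2r la; first exact: convex_smallest.
move=> x /= lx; pose c := pickle (n, index x (W (map u s) (u i) n)).
exists (GenTree.Node c (i :: s)).
  rewrite /u /= /c pickleK nth_index//.
  by apply: quasi_orth_le (ltW ne) _; have [] := lW _ lx.
by rewrite /u /= /c pickleK nth_index.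
Qed.

End Skeleton.

(** * Auxiliary functionals and slices *)

Section Functionals.
Context {R : realType} {X : normedModType R}.

Lemma linear_combination (f g : {linear X -> R^o}) (a b : R) :
  exists h : {linear X -> R^o}, forall x, h x = a * f x + b * g x.
Proof.
pose h x := a * f x + b * g x.
have hlin : linear (h : X -> R^o).
  by move=> c x y; rewrite /h !linearP /= /GRing.scale /=; lra.
pose hL := GRing.isLinear.Build R X R^o _ (h : X -> R^o) hlin.
pose h' : {linear X -> R^o} := HB.pack (h : X -> R^o) hL.
by exists h'.
Qed.

(** A nonzero space with the Daugavet property has dimension at least two: the
    vector [x - f x *: e1] below does not vanish when [x] is quasi-orthogonal to [e1]. *)
Lemma biorthogonal_pair : (exists x : X, x != 0) -> daugavet X ->
  exists (h1 h2 : {linear X -> R^o}) (e1 e2 : X) (K : R),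
    [/\ 0 < K, forall x, `|h1 x| <= K * `|x| /\ `|h2 x| <= K * `|x|,
        h1 e1 = 1 /\ h1 e2 = 0 & h2 e1 = 0 /\ h2 e2 = 1].
Proof.
move=> X0 Xd; have [v v0] := X0; have [f [f1 fv]] := norming_functional v.
have vn : 0 < `|v| by rewrite normr_gt0.
pose e1 := `|v|^-1 *: v.
have fe1 : f e1 = 1 by rewrite functionalZ fv mulVf// gt_eqF.
have e11 : `|e1| = 1 by rewrite normrZ normfV normr_id mulVf// gt_eqF.
have [x [x1 _ xo]] : exists z, [/\ `|z| <= 1, 0 < f z & quasi_orth 1 [:: e1] 2^-1 z].
  apply: (@slice_quasi_orth _ _ X0 Xd 1 [:: e1] f 1 0 e1) => //.
  - by move=> z; rewrite mul1r.
  - by rewrite e11.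
  - by rewrite fe1.
have w0 : 0 < `|x - f x *: e1|.
  have : box 1 [:: e1] (- (f x *: e1)).
    exists (- f x), 0; rewrite normrN addr0 scaleNr; split=> //.
    exact: le_trans (f1 x) x1.
  move=> bx; have := xo _ 1 bx; rewrite ler01 lexx scale1r => /(_ isT).
  rewrite (addrC _ x); have := normr_ge0 (- (f x *: e1)); lra.
set w := x - _ in w0.
have [g [g1 gw]] := norming_functional w.
pose b := `|w|^-1 * g e1.
have [h2 h2E] := linear_combination g f `|w|^-1 (- b).
exists f, h2, e1, w, (1 + `|w|^-1 + `|b|).
have fw : f w = 0 by rewrite linearB functionalZ fe1 mulr1 subrr.
have wi : 0 < `|w|^-1 by rewrite invr_gt0.
split.
- have := normr_ge0 b; lra.
- move=> y; split.
    by apply: le_trans (f1 y) _; rewrite -addrA ler_peMl// lerDl addr_ge0// ltW.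
  rewrite h2E mulNr; apply: le_trans (ler_normB _ _) _.
  rewrite normrM (gtr0_norm wi) (normrM _ (f y)).
  have : `|w|^-1 * `|g y| <= `|w|^-1 * `|y| by rewrite ler_pM2l.
  have : `|b| * `|f y| <= `|b| * `|y| by rewrite ler_wpM2l.
  have := normr_ge0 y; lra.
- by [].
- rewrite !h2E fe1 fw gw mulr1 subrr mulr0 addr0 mulVf// gt_eqF//.
Qed.

(** Otherwise a closed half-space that misses the slice would contain [A], hence
    its closed convex hull, and the supremum of [f] would be too large. *)
Lemma slice_generator (A : set X) (f : {linear X -> R^o}) (e : R) :
  continuous f -> A !=set0 -> 0 < e ->
  exists2 a, A a & slice (closed_conv A) f e a.
Proof.
move=> fc [a0 Aa0] e0.
have [//|noa] := pselect (exists2 a, A a & slice (closed_conv A) f e a).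
have [K K0 fK] := continuous_linear_bound fc.
pose m := sup (f @` closed_conv A).
have fA x : closed_conv A x -> f x + (e - m) <= 0.
  apply: (closed_conv_le (convex_lipschitz_linear (e - m) fK)) => a Aa.
  rewrite leNgt; apply/negP => fa; apply: noa; exists a => //; split=> /=.
    exact: sub_closed_conv.
  by rewrite -/m; lra.
have : m <= m - e.
  apply: ge_sup; first by exists (f a0), a0 => //; exact: sub_closed_conv.
  by move=> _ [x Cx <-]; have := fA x Cx; lra.
lra.
Qed.

End Functionals.

Lemma unbounded_index (I : countType) (i : I) (N : nat) :
  exists m : nat, (N <= pickle (i, m))%N.
Proof.
have [//|nom] := pselect (exists m : nat, (N <= pickle (i, m))%N).
have gN (m : nat) : (pickle (i, m) < N)%N.
  by rewrite ltnNge; apply/negP => h; apply: nom; exists m.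
have /= : (size (map (fun m : nat => pickle (i, m)) (iota 0 N.+1)) <=
           size (iota 0 N))%N.
  apply: uniq_leq_size.
    rewrite map_inj_uniq ?iota_uniq// => m n /(pcan_inj pickleK) [].
    by [].
  by move=> _ /mapP[m _ ->]; rewrite mem_iota gN.
by rewrite size_map !size_iota ltnn.
Qed.

(** * Sums along a quasi-orthogonal sequence *)

Section QuasiOrthSequence.
Context {R : realType} {X : normedModType R}.

Lemma quasi_orth_sum (M : R) (s : nat -> seq X) (x : nat -> X) (e : nat -> R)
    (y : X) (nu : nat -> R) (n : nat) :
  1 <= M -> (forall n, s n.+1 = x n :: s n) ->
  (forall n, quasi_orth M (s n) (e n) (x n)) -> box M (s 0%N) y ->
  (forall i, (i < n)%N -> 0 <= nu i <= 1) ->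
  box M (s n) (y + \sum_(i < n) nu i *: x i) /\
  \sum_(i < n) nu i - \sum_(i < n) e i <= `|y + \sum_(i < n) nu i *: x i|.
Proof.
move=> M1 sS sx sy; elim: n => [|n ih] nu01; first by rewrite !big_ord0 addr0 subr0.
have [|sn le_n] := ih; first by move=> i /ltnW/nu01.
have nun := nu01 n (ltnSn n); have /andP[nu0 nu1] := nun.
rewrite !big_ord_recr /= addrA; split.
  rewrite sS; exists (nu n), (y + \sum_(i < n) nu i *: x i); split=> //.
    by rewrite ger0_norm// (le_trans nu1).
  by rewrite addrC.
by have := sx n _ _ sn nun; lra.
Qed.

Lemma sum_geometric (n : nat) : \sum_(i < n) 2^-1 ^+ (i + 3) <= 4^-1 :> R.
Proof.
suff -> : \sum_(i < n) 2^-1 ^+ (i + 3) = 4^-1 - 2^-1 ^+ (n + 2) :> R.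
  by rewrite gerBl exprn_ge0.
elim: n => [|n ih]; first by rewrite big_ord0 add0n; lra.
by rewrite big_ord_recr/= ih addSn !addnS !exprS; lra.
Qed.

End QuasiOrthSequence.

(** * The tipped set *)

Section Construction.
Context {R : realType} {X : normedModType R}.
Context (h1 h2 : {linear X -> R^o}) (e1 e2 : X) (K : R).
Context (K_gt0 : 0 < K) (h1K : forall x, `|h1 x| <= K * `|x|)
  (h2K : forall x, `|h2 x| <= K * `|x|).
Context (h1e1 : h1 e1 = 1) (h1e2 : h1 e2 = 0) (h2e1 : h2 e1 = 0)
  (h2e2 : h2 e2 = 1).
Context (I : countType) (u : I -> X) (i0 : I).
Context (u_le1 : forall i, `|u i| <= 1) (u_i0 : u i0 = 0).
Context (u_dense : forall (s : seq I) (i : I) (e : R), 0 < e ->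
  closed_conv
    [set u j | j in [set j | quasi_orth (2 + K) (map u s ++ [:: e1; e2]) e (u j)]]
    (u i)).

Definition proj x := x - h1 x *: e1 - h2 x *: e2.

(** Every index is attained infinitely often, because [(i, m)] is the code of
    arbitrarily large numbers when [m] varies. *)
Definition code_index (n : nat) : I :=
  (odflt (i0, 0%N) (unpickle n)).1.

(** The first two coordinates [h1] and [h2] of the flat points are [(1, 0)]. *)
Definition flat_point i := e1 + proj (u i).

(** The first two coordinates of the tips are [(tau n ^+ 2 - 1, tau n)]: they lie
    on a parabola that has the flat points in its interior, and tend to
    [(- 1, 0)], the opposite of the coordinates of the flat points. *)
Definition tip n :=
  (tau n ^+ 2 - 1) *: e1 + tau n *: e2 - proj (u (code_index n)).

Definition generators := range flat_point `|` range tip.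

Definition tipped_set := closed_conv generators.

Lemma h1_proj x : h1 (proj x) = 0.
Proof.
by rewrite /proj !linearB !(functionalZ h1) h1e1 h1e2 mulr0 mulr1 subr0 subrr.
Qed.

Lemma h2_proj x : h2 (proj x) = 0.
Proof.
by rewrite /proj !linearB !(functionalZ h2) h2e1 h2e2 mulr0 mulr1 subr0 subrr.
Qed.

Lemma h1_flat i : h1 (flat_point i) = 1.
Proof. by rewrite linearD h1_proj h1e1 addr0. Qed.

Lemma h2_flat i : h2 (flat_point i) = 0.
Proof. by rewrite linearD h2_proj h2e1 addr0. Qed.

Lemma h1_tip n : h1 (tip n) = tau n ^+ 2 - 1.
Proof.
by rewrite linearB linearD !(functionalZ h1) h1_proj h1e1 h1e2 mulr0 mulr1 addr0 subr0.
Qed.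

Lemma h2_tip n : h2 (tip n) = tau n.
Proof.
by rewrite linearB linearD !(functionalZ h2) h2_proj h2e1 h2e2 mulr0 mulr1 add0r subr0.
Qed.

Definition radius : R := 1 + (K + 1) * (`|e1| + `|e2|).

Lemma radius_gt0 : 0 < radius.
Proof. by rewrite ltr_wpDr// mulr_ge0// addr_ge0// ltW. Qed.

Lemma norm_proj i : `|proj (u i)| <= 1 + K * (`|e1| + `|e2|).
Proof.
rewrite /proj -addrA; apply: le_trans (ler_normD _ _) _; rewrite lerD//.
rewrite -opprD normrN; apply: le_trans (ler_normD _ _) _.
have h e (h : {linear X -> R^o}) : (forall x, `|h x| <= K * `|x|) ->
    `|h (u i) *: e| <= K * `|e|.
  move=> hK; rewrite normrZ ler_wpM2r//; apply: le_trans (hK _) _.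
  by rewrite ler_piMr// ltW.
by rewrite mulrDr lerD// h.
Qed.

Lemma norm_generators x : generators x -> `|x| <= radius.
Proof.
have n1 := normr_ge0 e1; have n2 := normr_ge0 e2.
rewrite /radius; move=> [[i _ <-]|[n _ <-]]; have := norm_proj.
  move=> /(_ i) pi; apply: le_trans (ler_normD _ _) _; lra.
move=> /(_ (code_index n)) pi; apply: le_trans (ler_normB _ _) _.
have t0 := @tau_gt0 R n; have t1 := @tau_le1 R n.
have : `|(tau n ^+ 2 - 1) *: e1 + tau n *: e2| <= `|e1| + `|e2|.
  apply: le_trans (ler_normD _ _) _; rewrite !normrZ; apply: lerD.
    rewrite ler_piMl// distrC ger0_norm ?subr_ge0 ?expr_le1// ?(ltW t0)//.
    by rewrite lerBlDr lerDl exprn_ge0// ltW.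
  by rewrite ler_piMl// ger0_norm// ltW.
lra.
Qed.

Lemma norm_tipped_set x : tipped_set x -> `|x| <= radius.
Proof.
move=> Cx.
pose phi (y : X) : R := `|y - 0| + ((\0 : {linear X -> R^o}) y + - radius).
suff : phi x <= 0 by rewrite /phi /= subr0; lra.
apply: (closed_conv_le _ _ Cx) => [|a /norm_generators]; last first.
  by rewrite /phi /= subr0; lra.
apply: convex_lipschitzD (convex_lipschitz_norm 0) _.
apply: (@convex_lipschitz_linear _ _ (\0 : {linear X -> R^o}) (- radius) 0) => y.
by rewrite /= normr0 mul0r.
Qed.

Lemma bounded_tipped_set : bounded_set tipped_set.
Proof.
exists radius; split=> [|M rM x Cx]; first exact: num_real.
exact: le_trans (norm_tipped_set Cx) (ltW rM).
Qed.

Lemma tipped_set_neq0 : tipped_set !=set0.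
Proof. by exists (flat_point i0); apply: sub_closed_conv; left; exists i0. Qed.

(** The functional [- h1 + 2 tau n h2] is, on the plane of the first two
    coordinates, maximal over the parabola at its [n]-th point only; its values
    at the other points of the parabola fall short by [(tau m - tau n) ^+ 2].
    The resulting gap bounds the distance to [tip n] on all generators, and the
    bound is convex. *)
Lemma tip_strongly_exposed n : exists (f : {linear X -> R^o}) (L : R),
  [/\ continuous f, f e1 != 0, 0 < L &
      forall x, tipped_set x -> `|x - tip n| <= L * (f (tip n) - f x)].
Proof.
have [d /andP[d0 d1] dP] := @tau_gap R n.
have r0 := radius_gt0.
pose L := 2 * radius / d.
have L0 : 0 < L by rewrite divr_gt0// mulr_gt0.
have Ld : L * d = 2 * radius by rewrite /L divfK// gt_eqF.
have [f fE] := linear_combination h1 h2 (- 1) (2 * tau n).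
have [g gE] := linear_combination f f L 0.
have t0 := @tau_gt0 R n.
have fK x : `|f x| <= (1 + 2) * K * `|x|.
  rewrite fE mulN1r addrC; apply: le_trans (ler_normB _ _) _.
  rewrite normrM ger0_norm ?mulr_ge0// ?(ltW t0)//.
  have : tau n * `|h2 x| <= `|h2 x| by rewrite ler_piMl// tau_le1.
  have := h1K x; have := h2K x; lra.
exists f, L; split=> //.
- exact: bound_continuous fK.
- by rewrite fE h1e1 h2e1 mulr0 addr0 mulr1 oppr_eq0 oner_eq0.
move=> x Cx.
pose phi y := `|y - tip n| + (g y + - (L * f (tip n))).
suff : phi x <= 0 by rewrite /phi gE; lra.
apply: (closed_conv_le _ _ Cx) => [|a Ga].
  apply: convex_lipschitzD (convex_lipschitz_norm _) _.
  apply: (@convex_lipschitz_linear _ _ g _ (L * ((1 + 2) * K))) => y.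
  by rewrite gE mul0r addr0 normrM (gtr0_norm L0) -mulrA ler_pM2l.
rewrite /phi gE mul0r addr0.
have far : a = tip n \/ d <= f (tip n) - f a.
  rewrite !fE h1_tip h2_tip; case: Ga => [[i _ <-]|[m _ <-]].
    by rewrite h1_flat h2_flat; right; have := sqr_ge0 (tau n : R); lra.
  rewrite h1_tip h2_tip; have [->|/dP] := eqVneq m n; first by left.
  by right; lra.
have [->|fa] := far; first by rewrite subrr normr0 add0r subrr.
have : L * d <= L * (f (tip n) - f a) by rewrite ler_pM2l.
have := norm_generators Ga.
have : `|tip n| <= radius by apply: norm_generators; right; exists n.
have := ler_normB a (tip n); lra.
Qed.

(** A set that meets small slices around a tip has that tip in its closure.
    The tips carrying the index [i] tend to [- flat_point i], and a change of sign
    is allowed in an absolutely convex hull. *)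
Lemma aSCD_tipped_set : aSCD tipped_set.
Proof.
split; first exact: bounded_tipped_set.
have /choice[F FP] := tip_strongly_exposed.
pose S (k : nat * nat) := slice tipped_set (F k.1) (tau k.2).
pose dec n : nat * nat := odflt (0%N, 0%N) (unpickle n).
exists (fun n => S (dec n)); split=> [n|B BS].
  split; [exact: tipped_set_neq0|exact: bounded_tipped_set|].
  have [L [Fc Fe _ _]] := FP (dec n).1.
  by exists (F (dec n).1), (tau (dec n).2); split=> //; [exists e1|exact: tau_gt0].
have tipB n : closed_aconv B (tip n).
  apply: closed_aconv_closure; apply/closureP => e e0.
  have [L [Fc _ L0 FL]] := FP n.
  have [m /(_ m (leqnn m)) me] := tau_small (divr_gt0 e0 L0).
  have := BS (pickle (n, m)); rewrite /dec pickleK /= => -[b [Bb [Cb Fb]]].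
  exists b => //; rewrite distrC; apply: le_lt_trans (FL b Cb) _.
  rewrite mulrC -ltr_pdivlMr//; apply: le_lt_trans me.
  suff : F n (tip n) <= sup (F n @` tipped_set) by move: Fb => /=; lra.
  apply: ub_le_sup; last first.
    by exists (tip n) => //; apply: sub_closed_conv; right; exists n.
  exists (F n (tip n)) => _ [x Cx <-].
  have := FL x Cx; have := normr_ge0 (x - tip n) => /le_trans /[apply].
  by rewrite pmulr_rge0// subr_ge0.
have flatB i : closed_aconv B (flat_point i).
  suff : closure (closed_aconv B) (flat_point i).
    exact: closed_closure.
  apply/closureP => e e0.
  have N0 : 0 < `|e1| + `|e2| + 1 by rewrite ltr_wpDl// addr_ge0.
  have [N NP] := tau_small (divr_gt0 e0 N0).
  have [m Nm] := unbounded_index i N; set n := pickle (i, m) in Nm.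
  exists (- tip n); first exact/closed_aconvN/tipB.
  have ni : code_index n = i by rewrite /code_index pickleK.
  have -> : flat_point i - - tip n = tau n ^+ 2 *: e1 + tau n *: e2.
    rewrite opprK /flat_point /tip ni scalerBl scale1r.
    by rewrite addrC (addrC e1) addrA subrK addrAC subrK.
  have t0 := @tau_gt0 R n; have t1 := @tau_le1 R n.
  apply: le_lt_trans (ler_normD _ _) _; rewrite !normrZ.
  rewrite (gtr0_norm t0).
  have : tau n * (`|e1| + `|e2| + 1) < e by rewrite -ltr_pdivlMr// NP.
  have : tau n * tau n * `|e1| <= tau n * `|e1|.
    by rewrite -mulrA ler_pM2l// ler_piMl.
  lra.
apply: closed_conv_sub => [||_ [[i _ <-]|[n _ <-]]] //.
- exact: convex_closed_aconv.
- exact: closed_closure.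
Qed.

(** A slice without tips contains a flat point, hence a quasi-orthogonal one: as
    [f \o flat_point] is an affine function of [u i], it cannot be large at [u i]
    and small on a set having [u i] in its closed convex hull. *)
Lemma slice_quasi_orth_choice (S : set X) (s : seq I) (e : R) :
  is_slice tipped_set S -> 0 < e ->
  exists j b, [/\ S b, quasi_orth (2 + K) (map u s ++ [:: e1; e2]) e (u j) &
     b = flat_point j \/ range tip b].
Proof.
move=> [_ _ [f [d [fc _ d0 ->]]]] e0.
pose J j := quasi_orth (2 + K) (map u s ++ [:: e1; e2]) e (u j).
have G0 : generators !=set0 by exists (flat_point i0); left; exists i0.
have [L L0 fL] := continuous_linear_bound fc.
have [b [[i _ ib]|tb] Sb] := slice_generator fc G0 d0; last first.
  have [j js] : exists j, J j.
    have [//|noj] := pselect (exists j, J j).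
    have c0 : convex_set (set0 : set X) by apply/convex_setP.
    exfalso; apply: (closed_conv_sub c0 (@closed0 X) _ (@u_dense s i0 e e0)).
    by move=> x [j js _]; apply: noj; exists j.
  by exists j, b; split=> //; right.
pose m := sup (f @` tipped_set) - d.
have [j jo jm] : exists2 j, J j & m < f (flat_point j).
  have [//|noj] := pselect (exists2 j, J j & m < f (flat_point j)).
  have [f1 f1E] := linear_combination f h1 1 (- f e1).
  have [f2 f2E] := linear_combination f1 h2 1 (- f e2).
  have fproj x : f2 x = f (proj x).
    rewrite f2E f1E !linearB !(functionalZ f); lra.
  have f2K x : `|f2 x| <= (L + `|f e1| * K + `|f e2| * K) * `|x|.
    rewrite f2E f1E !mul1r.
    apply: le_trans (ler_normD _ _) _; rewrite mulrDl; apply: lerD.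
      apply: le_trans (ler_normD _ _) _; rewrite mulrDl; apply: lerD => //.
      by rewrite normrM normrN -mulrA ler_wpM2l.
    by rewrite normrM normrN -mulrA ler_wpM2l.
  have : f2 (u i) + (f e1 - m) <= 0.
    have phiP := convex_lipschitz_linear (f e1 - m) f2K.
    apply: (closed_conv_le phiP _ (@u_dense s i e e0)).
    move=> _ [j js <-]; rewrite leNgt; apply/negP => mj; apply: noj.
    by exists j => //; rewrite linearD -fproj; lra.
  by move: Sb => [_ /=]; rewrite -ib linearD -fproj -/m; lra.
exists j, (flat_point j); split=> //; last by left.
by split=> //; apply: sub_closed_conv; left; exists j.
Qed.

Lemma flat_sum (x : nat -> I) (nu : nat -> R) n :
  \sum_(i < n) nu i *: flat_point (x i) =
  (\sum_(i < n) nu i * (1 - h1 (u (x i)))) *: e1 +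
  (\sum_(i < n) nu i * - h2 (u (x i))) *: e2 + \sum_(i < n) nu i *: u (x i).
Proof.
rewrite !scaler_suml -!big_split /=; apply: eq_bigr => i _.
rewrite -!scalerA -!scalerDr /flat_point /proj scalerBl scale1r scaleNr.
by rewrite [u _ - _]addrC !addrA addrAC.
Qed.

(** A convex set that contains the flat points [flat_point (x n)] and all the
    tips. The part [v] gathers the tips with total weight [mu]: their positions
    are forgotten, only the inequality for [h1] is kept, as it tells them from
    flat points. Asking for the identities at all large [n] makes it possible to
    combine mixtures of different lengths. *)
Definition mixture (x : nat -> I) (z : X) :=
  exists (N : nat) (nu : nat -> R) (mu : R) (v : X),
    [/\ forall i, 0 <= nu i,
        forall n, (N <= n)%N -> \sum_(i < n) nu i + mu = 1,
        forall n, (N <= n)%N ->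
          z = \sum_(i < n) nu i *: flat_point (x i) + v,
        `|v| <= radius * mu & h1 v <= 0].

Lemma convex_mixture x : convex_set (mixture x).
Proof.
apply/convex_setP => y z t /andP[t0 t1].
move=> [N [nu [mu [v [nu0 nu1 nuE vmu hv]]]]].
move=> [P [xi [rho [w [xi0 xi1 xiE wrho hw]]]]].
exists (maxn N P), (fun i => t * nu i + (1 - t) * xi i), (t * mu + (1 - t) * rho),
  (t *: v + (1 - t) *: w).
have s0 : 0 <= 1 - t by rewrite subr_ge0.
split=> [i|n|n||].
- by rewrite addr_ge0// mulr_ge0.
- rewrite geq_max => /andP[/nu1 nun /xi1 xin].
  rewrite big_split /= -!mulr_sumr.
  have -> : \sum_(i < n) nu i = 1 - mu by lra.
  have -> : \sum_(i < n) xi i = 1 - rho by lra.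
  lra.
- rewrite geq_max => /andP[/nuE -> /xiE ->].
  rewrite !scalerDr addrACA !scaler_sumr -big_split /=; congr (_ + _).
  by apply: eq_bigr => i _; rewrite [RHS]scalerDl !scalerA.
- apply: le_trans (ler_normD _ _) _; rewrite !normrZ !ger0_norm//.
  have : t * `|v| <= t * (radius * mu) by rewrite ler_wpM2l.
  have : (1 - t) * `|w| <= (1 - t) * (radius * rho) by rewrite ler_wpM2l.
  lra.
- rewrite linearD !(functionalZ h1).
  have : t * h1 v <= 0 by rewrite mulr_ge0_le0.
  have : (1 - t) * h1 w <= 0 by rewrite mulr_ge0_le0.
  lra.
Qed.

Lemma mixture_flat x n : mixture x (flat_point (x n)).
Proof.
exists n.+1, (fun i => (i == n)%:R), 0, 0; split=> [i|m nm|m nm||].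
- by rewrite ler0n.
- rewrite addr0 (bigD1 (Ordinal nm)) //= eqxx big1 ?addr0// => i.
  by rewrite -val_eqE /= => /negbTE ->.
- rewrite addr0 (bigD1 (Ordinal nm)) //= eqxx scale1r big1 ?addr0// => i.
  by rewrite -val_eqE /= => /negbTE ->; rewrite scale0r.
- by rewrite normr0 mulr0.
- by rewrite linear0.
Qed.

Lemma mixture_tip x n : mixture x (tip n).
Proof.
exists 0%N, (fun=> 0), 1, (tip n); split=> // [m _|m _||].
- by rewrite big1// add0r.
- by rewrite big1 ?add0r// => i _; rewrite scale0r.
- by rewrite mulr1 norm_generators//; right; exists n.
- by rewrite h1_tip subr_le0 expr_le1// ?tau_le1// ltW// tau_gt0.
Qed.

(** Since [h1] equals [1] at [e1] and at flat points, but is nonpositive on tips,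
    a mixture close to [e1] has a small tip weight [mu]. What remains is
    [e1]-[e2]-terms plus a combination of the [u (x i)] of total weight
    [1 - mu], whose norm is at least [1 - mu - 1 / 4] by quasi-orthogonality. *)
Lemma mixture_far (x : nat -> I) (s : nat -> seq I) z :
  s 0%N = [::] -> (forall n, s n.+1 = x n :: s n) ->
  (forall n, quasi_orth (2 + K) (map u (s n) ++ [:: e1; e2]) (2^-1 ^+ (n + 3))
     (u (x n))) ->
  mixture x z -> 3 / 4 <= `|z - e1| * (1 + (1 + radius) * K).
Proof.
move=> s0 sS xs [n [nu [mu [v [nu0 numu' zE' vmu hv]]]]].
have [numu zE] := (numu' n (leqnn n), zE' n (leqnn n)).
have r0 := radius_gt0.
have mu0 : 0 <= mu by rewrite -(pmulr_rge0 _ r0) (le_trans _ vmu).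
pose A := \sum_(i < n) nu i.
have A1 : A <= 1 by rewrite -numu lerDl.
have nu01 i : (i < n)%N -> 0 <= nu i <= 1.
  move=> ilt; rewrite nu0 /= (le_trans _ A1)// /A (bigD1 (Ordinal ilt))//= lerDl.
  by rewrite sumr_ge0.
have sumK (g : nat -> R) (c : R) : (forall i, `|g i| <= c) -> 0 <= c ->
    `|\sum_(i < n) nu i * g i| <= c.
  move=> gc c0; apply: le_trans (ler_norm_sum _ _ _) _.
  apply: (@le_trans _ _ (\sum_(i < n) nu i * c)); last first.
    by rewrite -mulr_suml ler_piMl.
  by apply: ler_sum => i _; rewrite normrM (ger0_norm (nu0 i)) ler_wpM2l.
have muK : mu <= K * `|z - e1|.
  apply: le_trans (h1K _); rewrite ler_normr; apply/orP; right.
  have h1z : h1 z = A + h1 v.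
    rewrite zE linearD linear_sum; congr (_ + _); apply: eq_bigr => i _.
    by rewrite (functionalZ h1) h1_flat mulr1.
  by rewrite (linearB h1) h1e1 h1z; move: numu; rewrite -/A; lra.
pose al := \sum_(i < n) nu i * (1 - h1 (u (x i))) - 1.
pose be := \sum_(i < n) nu i * - h2 (u (x i)).
have uK (h : {linear X -> R^o}) i : (forall x, `|h x| <= K * `|x|) -> `|h (u i)| <= K.
  by move=> hK; apply: le_trans (hK _) _; rewrite ler_piMr// ltW.
have boxe : box (2 + K) (map u (s 0%N) ++ [:: e1; e2]) (al *: e1 + be *: e2).
  rewrite s0 /=; exists al, (be *: e2); split=> //.
    apply: le_trans (ler_normB _ _) _; rewrite normr1.
    have : `|\sum_(i < n) nu i * (1 - h1 (u (x i)))| <= 1 + K.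
      apply: (sumK (fun i => 1 - h1 (u (x i)))) => [i|]; last by have := K_gt0; lra.
      by apply: le_trans (ler_normB _ _) _; rewrite normr1 lerD2l uK.
    lra.
  exists be, 0; split=> //; last by rewrite addr0.
  apply: (@le_trans _ _ K); last by rewrite lerDr.
  apply: (sumK (fun i => - h2 (u (x i)))) => [i|]; last exact: ltW.
  by rewrite normrN uK.
have M1 : 1 <= 2 + K by have := K_gt0; lra.
have sS' m : map u (s m.+1) ++ [:: e1; e2] = u (x m) :: (map u (s m) ++ [:: e1; e2]).
  by rewrite sS.
have [_] := @quasi_orth_sum _ _ _ (fun m => map u (s m) ++ [:: e1; e2])
  (fun m => u (x m)) _ _ nu n M1 sS' xs boxe nu01.
have -> : al *: e1 + be *: e2 + \sum_(i < n) nu i *: u (x i) = z - e1 - v.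
  rewrite zE flat_sum /al scalerBl scale1r.
  set p := \sum_(i < n) _ *: _; set q := (\sum_(i < n) _) *: e1.
  by rewrite (addrAC _ v) addrK -/be (addrAC q) (addrAC (q + _)).
have := @sum_geometric R n; rewrite -/A => geo le1.
have := ler_normB (z - e1) v.
have : radius * mu <= radius * (K * `|z - e1|) by rewrite ler_pM2l.
move: numu; rewrite -/A; lra.
Qed.

(** In each of the given slices one picks a tip or a flat point
    [flat_point (x n)], the [u (x n)] being successively quasi-orthogonal. The
    closed convex hull of the points chosen does not contain [e1], which is the
    flat point of index [i0]. *)
Lemma not_SCD_tipped_set : ~ SCD tipped_set.
Proof.
move=> [_ [S [Ssl SC]]].
have e0 n : 0 < 2^-1 ^+ (n + 3) :> R by rewrite exprn_gt0.
have /choice[F FP] : forall k : nat * seq I, exists p : I * X,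
    [/\ S k.1 p.2, quasi_orth (2 + K) (map u k.2 ++ [:: e1; e2])
       (2^-1 ^+ (k.1 + 3)) (u p.1) & p.2 = flat_point p.1 \/ range tip p.2].
  move=> [n s] /=.
  have [j [b [Sb jo jb]]] := slice_quasi_orth_choice s (Ssl n) (e0 n).
  by exists (j, b).
(* [s n] lists the indices chosen before stage [n]; in a slice where a tip is
   picked, the index merely continues the quasi-orthogonal sequence. *)
pose s := fix s n := if n is m.+1 then (F (m, s m)).1 :: s m else [::].
pose x n := (F (n, s n)).1; pose b n := (F (n, s n)).2.
have bx : range b `<=` mixture x.
  move=> _ [n _ <-]; have [_ _ [|[m _]]] := FP (n, s n); rewrite -/(b n).
    by move=> ->; exact: mixture_flat.
  by move=> <-; exact: mixture_tip.
have r0 := radius_gt0.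
have D0 : 0 < 1 + (1 + radius) * K by rewrite addr_gt0// mulr_gt0// addr_gt0.
have c0 : 0 < 3 / 4 / (1 + (1 + radius) * K) by rewrite !divr_gt0.
have e1E : flat_point i0 = e1.
  by rewrite /flat_point /proj u_i0 !linear0 !scale0r !subr0 addr0.
have : closed_conv (range b) e1.
  apply: SC; last by rewrite -e1E; apply: sub_closed_conv; left; exists i0.
  by move=> n; exists (b n); split; [exists n|have [] := FP (n, s n)].
move=> /closureP/(_ _ c0)[a /(smallest_sub (@convex_mixture x) bx) xa].
rewrite ltr_pdivlMr// distrC ltNge => /negP; apply.
apply: (mixture_far (s := s) _ _ _ xa) => // n.
by have [] := FP (n, s n).
Qed.

End Construction.

Theorem theorem4p3 (R : realType) (X : completeNormedModType R)
    (X_neq0 : exists x : X, x != 0) (X_daugavet : daugavet X) :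
  exists C : set X,
    [/\ convex_set C, closed C, bounded_set C, aSCD C & ~ SCD C].
Proof.
have [h1 [h2 [e1 [e2 [K [K0 hK [h11 h12] [h21 h22]]]]]]] :=
  biorthogonal_pair X_neq0 X_daugavet.
have [I [u [i0 [u1 u0 uo]]]] :=
  quasi_orth_skeleton X_neq0 X_daugavet (2 + K) [:: e1; e2].
have h1K x : `|h1 x| <= K * `|x| := (hK x).1.
have h2K x : `|h2 x| <= K * `|x| := (hK x).2.
exists (tipped_set h1 h2 e1 e2 u i0); split.
- exact: convex_closed_conv.
- exact: closed_closed_conv.
- exact (bounded_tipped_set e1 e2 K0 h1K h2K i0 u1).
- exact (aSCD_tipped_set K0 h1K h2K h11 h12 h21 h22 i0 u1).
- exact (not_SCD_tipped_set K0 h1K h2K h11 h12 u1 u0 uo).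
Qed.
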